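(* Let $k \ge 2$ be an integer, let $q(k) = \left\lfloor \frac{-1+\sqrt{8k-7}}{2} \right\rfloor$, and let $G$ be a $k$-tree on $n \ge k+q(k)+2$ vertices. Then $$\alpha_{\rm reg}(G) > \frac{24k}{48k^3 + 84k^2 - 72k - (16k^2-13)\sqrt{8k-7} + 36}\; n.$$
   Context: Graphs are finite and simple. For a graph $G$, $\alpha_{\rm reg}(G)$ denotes the regular independence number: the maximum cardinality of an independent set of $G$ all of whose vertices have the same degree in $G$. A $k$-tree is a graph obtained by starting with a complete graph $K_{k+1}$ and then repeatedly (zero or more times) adding a new vertex whose neighborhood, at the time it is added, consists of exactly $k$ vertices that form a clique. *)

(* Defs.v *)
From mathcomp Require Import all_boot all_order all_algebra.
From mathcomp Require Import reals.
Set Implicit Arguments.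
Unset Strict Implicit.
Unset Printing Implicit Defensive.
Import Order.TTheory GRing.Theory Num.Theory.

(* A finite simple graph is a symmetric irreflexive relation on a finType. *)
Section Graph.
Variables (T : finType) (e : rel T).

Definition degree (v : T) : nat := #|[set u | e v u]|.

Definition clique (A : {set T}) : bool :=
  [forall u in A, forall v in A, (u != v) ==> e u v].

Definition independent (A : {set T}) : bool :=
  [forall u in A, forall v in A, ~~ e u v].

(* Degrees are taken in the whole graph, not in the subgraph induced by A. *)
Definition same_degree (A : {set T}) : bool :=
  [forall u in A, forall v in A, degree u == degree v].

Definition alpha_reg : nat :=
  \max_(A : {set T} | independent A && same_degree A) #|A|.

(* [ktree_on k S]: the subgraph induced by S can be built as a k-tree.  When
   v is added to S, its neighbourhood at that time is [set u in S | e v u];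
   neighbours of v outside S are vertices added later. *)
Inductive ktree_on (k : nat) : {set T} -> Prop :=
| ktree_base (K : {set T}) :
    #|K| = k.+1 -> clique K -> ktree_on k K
| ktree_add (S : {set T}) (v : T) :
    ktree_on k S -> v \notin S ->
    #|[set u in S | e v u]| = k -> clique [set u in S | e v u] ->
    ktree_on k (v |: S).

Definition is_ktree (k : nat) : Prop := ktree_on k [set: T].

End Graph.

Local Open Scope ring_scope.

Definition q (R : realType) (k : nat) : int :=
  Num.floor ((-1 + Num.sqrt (8 * k%:R - 7)) / 2 : R).

(* Main.v *)
Require Import Defs.
From mathcomp Require Import all_boot all_order all_algebra.
From mathcomp Require Import reals.
From mathcomp Require Import zify ring lra.
Set Implicit Arguments.
Unset Strict Implicit.
Unset Printing Implicit Defensive.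
Import Order.TTheory GRing.Theory Num.Theory.

(* The vertices of degree k + i induce a graph which, coloured greedily in the
   construction order, needs no more colours than its clique number c_i; hence
   there are at most c_i * alpha_reg of them.  A clique Q with k + |Q| <= n has a
   vertex of degree at least k + |Q| - 1, whence c_i <= i + 1 for i <= q(k), and
   c_i <= k for i < k; always c_i <= k + 1.  Since the degrees sum to
   2kn - k(k + 1), summing 2k - i over the vertices of degree k + i < 3k gives
   kn + k(k + 1) <= alpha_reg * S with S = sum_(i < 2k) (2k - i) c_i, and 24 S is
   at most the denominator of the stated bound. *)

Section KTree.
Variables (T : finType) (e : rel T) (k : nat).
Hypotheses (e_sym : symmetric e) (e_irr : irreflexive e).
Implicit Types (S A B Q W : {set T}) (u v w : T).

(** * Cliques and neighbourhoods *)

Lemma cliqueP A :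
  reflect {in A &, forall u v, u != v -> e u v} (clique e A).
Proof.
apply: (iffP forall_inP) => [H u v uA vA uv | H u uA].
  by have /forall_inP/(_ v vA)/implyP := H u uA; apply.
by apply/forall_inP => v vA; apply/implyP; apply: H.
Qed.

Lemma sub_clique A B : A \subset B -> clique e B -> clique e A.
Proof.
move=> /subsetP AB /cliqueP H; apply/cliqueP => u v /AB uB /AB vB.
exact: H.
Qed.

Definition nbhd S v : {set T} := [set u in S | e v u].

Lemma nbhd_addv S v : nbhd (v |: S) v = nbhd S v.
Proof.
apply/setP => u; rewrite !inE; case: eqVneq => [->|] //.
by rewrite e_irr !andbF.
Qed.

Lemma card_nbhd_add S v u :
  v \notin S -> #|nbhd (v |: S) u| = #|nbhd S u| + e u v.
Proof.
move=> vS; case euv: (e u v).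
  have -> : nbhd (v |: S) u = v |: nbhd S u.
    by apply/setP => w; rewrite !inE; case: eqVneq => [->|] //; rewrite euv.
  by rewrite cardsU1 !inE (negPf vS) addnC.
rewrite addn0; congr #|pred_of_set _|.
by apply/setP => w; rewrite !inE; case: eqVneq => [->|] //; rewrite euv !andbF.
Qed.

Lemma clique_addv S v Q : clique e Q -> Q \subset nbhd S v -> clique e (v |: Q).
Proof.
move=> /cliqueP cQ /subsetP sQ; apply/cliqueP => x y; rewrite !in_setU1.
case/predU1P=> [-> | xQ] /predU1P[-> | yQ]; rewrite ?eqxx // => xy.
- by have := sQ y yQ; rewrite inE => /andP[].
- by rewrite e_sym; have := sQ x xQ; rewrite inE => /andP[].
- exact: cQ.
Qed.

Lemma clique_subD1_nbhd S v Q :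
  Q \subset v |: S -> v \in Q -> clique e Q -> Q :\ v \subset nbhd S v.
Proof.
move=> /subsetP sQ vQ /cliqueP cQ; apply/subsetP => u; rewrite !inE => /andP[uv uQ].
rewrite (cQ v u) // 1?eq_sym // andbT.
by have := sQ u uQ; rewrite !inE (negPf uv).
Qed.

Lemma sub_setU1_notin S v Q : Q \subset v |: S -> v \notin Q -> Q \subset S.
Proof. by rewrite -subDset => + vQ; rewrite (setDidPl _) // disjoint_sym disjoints1. Qed.

(** * Clique number, minimum degree and degree sum of a k-tree *)

(** If a clique contains the vertex added last, the rest of it lies among the [k] neighbours which
    that vertex receives. *)
Lemma ktree_clique_card S Q :
  ktree_on e k S -> Q \subset S -> clique e Q -> #|Q| <= k.+1.
Proof.
move=> kS; elim: kS Q => [K cK _ Q /subset_leq_card | {}S v _ IH vS dv _ Q sQ cQ].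
  by rewrite cK.
have [vQ|vQ] := boolP (v \in Q); last exact: IH (sub_setU1_notin sQ vQ) cQ.
rewrite (cardsD1 v) vQ add1n ltnS -dv.
exact: subset_leq_card (clique_subD1_nbhd sQ vQ cQ).
Qed.

Lemma ktree_nbhd_card_ge S v : ktree_on e k S -> v \in S -> k <= #|nbhd S v|.
Proof.
move=> kS; elim: kS v => [K cK /cliqueP clK v vK | {}S v _ IH vS dv _ u].
  rewrite -ltnS -cK (cardsD1 v K) vK add1n ltnS; apply/subset_leq_card/subsetP => u.
  by rewrite !inE => /andP[uv uK]; rewrite uK clK // eq_sym.
rewrite in_setU1 => /predU1P[-> | uS]; first by rewrite nbhd_addv dv.
by rewrite card_nbhd_add // (leq_trans (IH u uS)) // leq_addr.
Qed.

(** Each added vertex brings [k] edges and so raises the degree sum by [2 * k]; the term [k * k.+1]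
    balances the initial clique and avoids truncated subtraction. *)
Lemma ktree_sum_degrees S :
  ktree_on e k S -> \sum_(v in S) #|nbhd S v| + k * k.+1 = 2 * k * #|S|.
Proof.
elim=> [K cK /cliqueP clK | {}S v _ IH vS dv _].
  rewrite (eq_bigr (fun _ => k)) => [|v vK]; first by rewrite sum_nat_const cK; lia.
  apply/eqP; rewrite -eqSS -cK (cardsD1 v K) vK add1n eqSS.
  rewrite (_ : nbhd K v = K :\ v) //; apply/setP => u; rewrite !inE.
  case: eqVneq => [-> | uv]; first by rewrite e_irr !andbF.
  by case uK: (u \in K) => //=; rewrite clK // eq_sym.
rewrite big_setU1 //= nbhd_addv dv cardsU1 vS.
under eq_bigr => u _ do rewrite card_nbhd_add //.
rewrite big_split /=.
suff -> : \sum_(u in S) e u v = k by lia.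
rewrite -dv -sum1_card big_mkcond [RHS]big_mkcond; apply: eq_bigr => u _.
by rewrite !inE e_sym; case: (u \in S); case: (e v u).
Qed.

(** * Universal vertices and large degrees in cliques *)

Definition universal S u : bool := [forall w in S, (w != u) ==> e u w].

Lemma universalP S u :
  reflect {in S, forall w, w != u -> e u w} (universal S u).
Proof.
apply: (iffP forall_inP) => H w wS; first exact/implyP/H.
by apply/implyP/H.
Qed.

Lemma universalE S u : u \in S -> universal S u = (#|S| <= #|nbhd S u|.+1).
Proof.
move=> uS; rewrite (cardsD1 u S) uS add1n ltnS.
have sub : nbhd S u \subset S :\ u.
  apply/subsetP => w; rewrite !inE => /andP[-> euw]; rewrite andbT.
  by apply: contraTneq euw => ->; rewrite e_irr.
apply/universalP/idP => [H | le].
  apply/subset_leq_card/subsetP => w; rewrite !inE => /andP[wu wS].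
  by rewrite wS H.
move=> w wS wu; have /eqP/setP/(_ w) : nbhd S u == S :\ u by rewrite eqEcard sub.
by rewrite !inE wu wS.
Qed.

(* When a vertex v is added, its neighbourhood together with the universal
   vertices is a clique, hence has at most k + 1 elements: at most one universal
   vertex fails to be adjacent to v. *)
Lemma ktree_clique_universal S Q :
  ktree_on e k S -> Q \subset S -> clique e Q ->
  #|Q| + k.+1 <= #|[set u in Q | universal S u]| + #|S|.
Proof.
move=> kS; elim: kS Q => [K cK /cliqueP clK Q /subsetP sQ _ | {}S v kS IH vS dv clN Q sQ cQ].
  rewrite cK leq_add2r; apply/subset_leq_card/subsetP => u uQ; rewrite inE uQ.
  by apply/universalP => w wK wu; apply: clK => //; [exact: sQ | rewrite eq_sym].
rewrite (cardsU1 v S) vS add1n.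
have [vQ|vQ] := boolP (v \in Q).
  have sN := clique_subD1_nbhd sQ vQ cQ.
  have sS : Q :\ v \subset S.
    by apply: subset_trans sN _; apply/subsetP => u; rewrite inE => /andP[].
  have := IH _ sS (sub_clique (subsetDl _ _) cQ).
  have : #|[set u in Q :\ v | universal S u]| <= #|[set u in Q | universal (v |: S) u]|.
    apply/subset_leq_card/subsetP => u; rewrite !inE => /andP[/andP[uv uQ] /universalP Hu].
    rewrite uQ; apply/universalP => w /setU1P[-> _ | wS]; last exact: Hu.
    have /(subsetP sN) : u \in Q :\ v by rewrite !inE uv.
    by rewrite inE e_sym => /andP[].
  by rewrite (cardsD1 v Q) vQ; lia.
have sS := sub_setU1_notin sQ vQ.
have := IH Q sS cQ; set U := [set u in Q | universal S u].
set U' := [set u in Q | universal (v |: S) u]; set N := nbhd S v.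
(* A vertex of [U] stops being universal only if it is not adjacent to [v]. *)
have sUU' : U \subset U' :|: U :\: N.
  apply/subsetP => u uU; rewrite in_setU in_setD uU andbT orbC.
  case: (boolP (u \in N)) => //= uN; move: uU uN; rewrite !inE => /andP[uQ /universalP Hu] /andP[_ evu].
  rewrite uQ; apply/universalP => w /setU1P[-> _ | wS]; last exact: Hu.
  by rewrite e_sym.
have sNU : N :|: U \subset S.
  apply/subsetP => u; rewrite !inE => /orP[/andP[] | /andP[uQ _]] //.
  exact: (subsetP sS).
have cNU : clique e (N :|: U).
  apply/cliqueP => x y xNU yNU xy.
  have [xS yS] := (subsetP sNU x xNU, subsetP sNU y yNU).
  case/setUP: xNU => [xN | ]; last first.
    by rewrite inE => /andP[_ /universalP]; apply=> //; rewrite eq_sym.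
  case/setUP: yNU => [yN | ]; first by move/cliqueP: clN; apply.
  by rewrite inE e_sym => /andP[_ /universalP]; apply.
(* Since [N] has [k] elements, [U :\: N] has at most one; its possible loss is offset by [S] gaining
   the vertex [v]. *)
have := ktree_clique_card kS sNU cNU.
have := subset_leq_card sUU'; have [+ _] := leq_card_setU U' (U :\: N).
have := cardsUI N U; have := cardsID N U; rewrite (setIC U N).
by rewrite [#|N|]dv; lia.
Qed.

(** When [k + #|Q| = #|S|], the previous count leaves a universal vertex in [Q]. Beyond that size,
    induct on the construction: if the last vertex [v] lies in [Q], a witness for [Q :\ v] gains the
    neighbour [v]; otherwise the witness for [Q] persists. *)
Lemma ktree_clique_degree S Q :
  ktree_on e k S -> Q \subset S -> clique e Q -> 0 < #|Q| -> k + #|Q| <= #|S| ->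
  exists2 u, u \in Q & k + #|Q| <= #|nbhd S u|.+1.
Proof.
have full S' Q' : ktree_on e k S' -> Q' \subset S' -> clique e Q' ->
    k + #|Q'| = #|S'| -> exists2 u, u \in Q' & k + #|Q'| <= #|nbhd S' u|.+1.
  move=> kS sQ cQ eqS; have := ktree_clique_universal kS sQ cQ.
  rewrite -eqS => le; have /card_gt0P[u] : 0 < #|[set u in Q' | universal S' u]| by lia.
  rewrite inE => /andP[uQ]; rewrite universalE ?(subsetP sQ) // -eqS => uni.
  by exists u.
move=> kS; elim: kS Q => [K cK clK | {}S v kS IH vS dv clN] Q sQ cQ Q0 leS.
  by apply: full => //; [exact: ktree_base | lia].
have kvS : ktree_on e k (v |: S) by exact: ktree_add.
have [eqS|neS] := eqVneq (k + #|Q|) #|v |: S|; first exact: full.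
have ltS : k + #|Q| <= #|S| by move: neS leS; rewrite cardsU1 vS; lia.
have [vQ|vQ] := boolP (v \in Q); last first.
  have [u uQ Hu] := IH Q (sub_setU1_notin sQ vQ) cQ Q0 ltS.
  by exists u => //; rewrite card_nbhd_add //; lia.
have sN := clique_subD1_nbhd sQ vQ cQ.
have sS : Q :\ v \subset S.
  by apply: subset_trans sN _; apply/subsetP => u; rewrite inE => /andP[].
have cardQ : #|Q| = #|Q :\ v|.+1 by rewrite (cardsD1 v Q) vQ.
(* For [Q] reduced to [v], the [k] neighbours of [v] suffice. *)
have [Q1|Q1] := posnP #|Q :\ v|.
  by exists v => //; rewrite nbhd_addv dv; lia.
have [|u uQ Hu] := IH _ sS (sub_clique (subsetDl _ _) cQ) Q1; first by lia.
exists u; first by move: uQ; rewrite inE => /andP[].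
rewrite card_nbhd_add // e_sym; have := subsetP sN u uQ.
by rewrite inE => /andP[_ ->]; lia.
Qed.

(** * Colouring of induced subgraphs *)

(* Greedy colouring in construction order: the earlier neighbours of a vertex
   form a clique. *)
Lemma ktree_coloring S W c :
  ktree_on e k S ->
  (forall Q, Q \subset W :&: S -> clique e Q -> #|Q| <= c.+1) ->
  exists f : T -> 'I_c.+1, {in W :&: S &, forall u w, e u w -> f u != f w}.
Proof.
elim=> [K cK clK | {}S v kS IH vS dv clN] Hc.
  have cWK := sub_clique (subsetIr W K) clK.
  have le := Hc _ (subxx _) cWK.
  (* On the initial clique, vertices are coloured by their position in an enumeration; the clique
     bound keeps these positions below [c.+1], so [inord] is faithful there. *)
  exists (fun u => inord (index u (enum (W :&: K)))) => u w uWK wWK.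
  apply: contraTneq => /(congr1 val) /=; rewrite !inordK; last first.
  - by rewrite (leq_trans _ le) // cardE index_mem mem_enum.
  - by rewrite (leq_trans _ le) // cardE index_mem mem_enum.
  move/index_inj => -> //; rewrite ?mem_enum // e_irr //.
have [f Hf] : exists f : T -> 'I_c.+1, {in W :&: S &, forall u w, e u w -> f u != f w}.
  apply: IH => Q sQ; apply: Hc; apply: subset_trans sQ _.
  by rewrite setIS // subsetUr.
have [vW|vW] := boolP (v \in W); last first.
  exists f; suff -> : W :&: (v |: S) = W :&: S by [].
  by apply/setP => u; rewrite !inE; case: eqVneq => [->|] //; rewrite (negPf vW).
pose N := W :&: nbhd S v.
(* Together with [v], the set [N] is a clique inside [W], so [N] has at most [c] elements and some
   colour is free for [v]. *)
have ltN : #|f @: N| < #|'I_c.+1|.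
  rewrite card_ord (leq_ltn_trans (leq_imset_card _ _)) //.
  have cvN : clique e (v |: N).
    by apply: clique_addv (subsetIr _ _); apply: sub_clique (subsetIr _ _) clN.
  have : v |: N \subset W :&: (v |: S).
    apply/subsetP => u; rewrite !inE => /predU1P[-> | /and3P[-> -> _]].
      by rewrite vW eqxx.
    by rewrite orbT.
  by move/Hc/(_ cvN); rewrite cardsU1 !inE (negPf vS) andbF add1n.
have /card_gt0P[j jN] : 0 < #|~: (f @: N)| by rewrite cardsCs setCK subn_gt0.
have freej u : u \in W -> u \in S -> e v u -> f u != j.
  move=> uW uS evu; apply: contraTneq jN => <-; rewrite inE negbK.
  by apply: imset_f; rewrite !inE uW uS.
exists (fun u => if u == v then j else f u) => u w.
rewrite !inE => /andP[uW uS] /andP[wW wS].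
case: eqVneq uS => [-> _ | uv /= uS]; case: eqVneq wS => [-> _ | wv /= wS].
- by rewrite e_irr.
- by move=> evw; rewrite eq_sym freej.
- by rewrite e_sym => evu; rewrite freej.
- by apply: Hf; rewrite !inE ?uW ?wW.
Qed.

(** * Sizes of the degree classes *)

Lemma degreeE v : degree e v = #|nbhd [set: T] v|.
Proof. by congr #|pred_of_set _|; apply/setP => u; rewrite !inE. Qed.

(** Colour the vertices of degree [d] with [c.+1] colours: each colour class is independent with
    constant degree, hence has at most [alpha_reg e] elements. *)
Lemma card_le_alpha_reg d c :
  is_ktree e k ->
  (forall Q, {in Q, forall v, degree e v = d} -> clique e Q -> #|Q| <= c.+1) ->
  #|[set v | degree e v == d]| <= c.+1 * alpha_reg e.
Proof.
move=> kG Hc; set W := [set v | _].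
have [Q|f Hf] := @ktree_coloring _ W c kG.
  rewrite setIT => /subsetP sQ; apply: Hc => v /sQ.
  by rewrite inE => /eqP.
rewrite -sum1_card (partition_big f xpredT) //= -[X in X * _]card_ord -sum_nat_const.
apply: leq_sum => j _; rewrite sum1dep_card.
apply: (@leq_bigmax_cond _ _ (fun A : {set T} => #|A|)); apply/andP; split.
  apply/forall_inP => u; rewrite inE => /andP[uW /eqP fu].
  apply/forall_inP => w; rewrite inE => /andP[wW /eqP fw].
  by apply/negP => /Hf; rewrite !in_setI uW wW !in_setT fu fw eqxx => /(_ isT isT).
apply/forall_inP => u; rewrite !inE => /andP[/eqP -> _].
by apply/forall_inP => w; rewrite !inE => /andP[/eqP -> _].
Qed.

(** Bounds the clique number of the class of degree [k + i], with [m] standing for q(k). The boolean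
    counts as 0 or 1: beyond [m] the value is [k], and [k + 1] once [k <= i]. *)
Definition clique_bound (m i : nat) : nat := if i <= m then i.+1 else k + (k <= i).

Lemma card_degree_le m i :
  is_ktree e k -> k + m.+2 <= #|T| -> 0 < k ->
  #|[set v | degree e v == k + i]| <= clique_bound m i * alpha_reg e.
Proof.
move=> kG leT k0.
have cb0 : 0 < clique_bound m i by rewrite /clique_bound; case: ifP => _; lia.
rewrite -(prednK cb0); apply: card_le_alpha_reg => // Q degQ cQ; rewrite prednK //.
have sQ := subsetT Q.
(* A subclique of [i.+2] vertices would contain one of degree at least [k + i + 1], whereas all
   vertices of [Q] have degree [k + i]. *)
have small : k + i.+2 <= #|T| -> #|Q| <= i.+1.
  move=> leT'; rewrite leqNgt; apply/negP => ltQ.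
  have [P sP cP] : exists2 P : {set T}, P \subset Q & #|P| = i.+2.
    have /card_geqP[s [us <- sQ']] := ltQ; exists [set u in s].
      by apply/subsetP => u; rewrite inE; apply: sQ'.
    by rewrite cardsE; apply/card_uniqP.
  have [||u uP] := ktree_clique_degree kG (subsetT P) (sub_clique sP cQ).
  - by rewrite cP.
  - by rewrite cP cardsT.
  by rewrite -degreeE degQ ?(subsetP sP) // cP; lia.
rewrite /clique_bound; case: (leqP i m) => im; first by apply: small; lia.
have leQ := ktree_clique_card kG sQ cQ.
case: (leqP k i) => ki; first by lia.
have [/small | ltT] := leqP (k + i.+2) #|T|; first by lia.
(* Here [#|T| <= k + i + 1], so degree [k + i] forces universality. A clique of [k + 1] such
   vertices would extend by any outside vertex, which exists as [#|T| >= k + 2]. *)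
have univ u : u \in Q -> universal [set: T] u.
  by move=> uQ; rewrite universalE ?inE // cardsT -degreeE degQ //; lia.
rewrite leqNgt addn0; apply/negP => ltQ.
have /card_gt0P[v vQ] : 0 < #|~: Q| by rewrite cardsCs setCK subn_gt0; lia.
have cvQ : clique e (v |: Q).
  apply: (@clique_addv [set: T]) => //; apply/subsetP => u uQ.
  rewrite !inE e_sym; have /universalP := univ u uQ; apply; rewrite ?inE //.
  by apply: contraTneq vQ => ->; rewrite inE negbK.
have := ktree_clique_card kG (subsetT _) cvQ.
by rewrite cardsU1; move: vQ; rewrite inE => ->; lia.
Qed.

Lemma ktree_order_le m :
  is_ktree e k -> k + m.+2 <= #|T| -> 0 < k ->
  k * #|T| + k * k.+1 <=
    alpha_reg e * \sum_(0 <= i < 2 * k) (2 * k - i) * clique_bound m i.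
Proof.
move=> kG leT k0.
have sumd : \sum_v degree e v + k * k.+1 = 2 * k * #|T|.
  rewrite -cardsT -(ktree_sum_degrees kG); congr (_ + _).
  by apply: eq_big => [v | v _]; rewrite ?inE // degreeE.
have mind v : k <= degree e v by rewrite degreeE; apply: ktree_nbhd_card_ge.
(* Truncated subtraction gives weight 0 to degrees above [3 * k], which only increases the
   right-hand side. *)
have H : 3 * k * #|T| <= \sum_v (3 * k - degree e v) + \sum_v degree e v.
  rewrite -big_split /= mulnC -sum_nat_const; apply: leq_sum => v _; lia.
have -> : alpha_reg e * (\sum_(0 <= i < 2 * k) (2 * k - i) * clique_bound m i) =
   \sum_(i < 2 * k) (2 * k - i) * (clique_bound m i * alpha_reg e).
  by rewrite big_mkord big_distrr /=; apply: eq_bigr => i _; lia.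
suff le : \sum_v (3 * k - degree e v) <=
   \sum_(i < 2 * k) (2 * k - i) * #|[set v | degree e v == k + i]|.
  have le' : \sum_(i < 2 * k) (2 * k - i) * #|[set v | degree e v == k + i]| <=
      \sum_(i < 2 * k) (2 * k - i) * (clique_bound m i * alpha_reg e).
    by apply: leq_sum => i _; rewrite leq_mul // card_degree_le.
  by apply: leq_trans le'; apply: leq_trans le; lia.
under [X in _ <= X]eq_bigr => i _ do rewrite -sum1_card big_distrr /= big_mkcond.
rewrite exchange_big /=; apply: leq_sum => v _.
case: (ltnP (degree e v - k) (2 * k)) => lt; last by have := mind v; lia.
(* The term of index [degree e v - k] alone already supplies the weight of [v]. *)
rewrite (bigD1 (Ordinal lt)) //= inE subnKC ?mind // eqxx.
by have := mind v; lia.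
Qed.

End KTree.
Local Open Scope ring_scope.

(** * Evaluation and estimate of the weighted sum *)

Lemma sum_rectangle (R : realFieldType) (x c : R) (a d : nat) :
  \sum_(a <= i < a + d) (x - i%:R) * c =
  c * (d%:R * x - d%:R * a%:R - d%:R * (d%:R - 1) / 2).
Proof.
elim: d => [|d IH]; first by rewrite addn0 big_geq //; field.
rewrite addnS big_nat_recr ?leq_addr //= IH natrD -natr1; by field.
Qed.

Lemma sum_staircase (R : realFieldType) (x : R) (d : nat) :
  \sum_(0 <= i < d) (x - i%:R) * i.+1%:R =
  d%:R * x + (x - 1) * d%:R * (d%:R - 1) / 2
  - d%:R * (d%:R - 1) * (2 * d%:R - 1) / 6.
Proof.
elim: d => [|d IH]; first by rewrite big_geq //; field.
by rewrite big_nat_recr //= IH -natr1; field.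
Qed.

(** Splitting at [m.+1] and [k] gives a staircase followed by blocks of constant heights [k] and
    [k + 1]. *)
Lemma sum_clique_bound (R : realFieldType) (k m : nat) : (m < k)%N ->
  24 * (\sum_(0 <= i < 2 * k) (2 * k - i) * clique_bound k m i)%N%:R =
  48 * k%:R ^+ 3 + 36 * k%:R ^+ 2 + 12 * k%:R
  - 48 * k%:R * (k%:R - 1) * (m%:R + 1)
  + 12 * (3 * k%:R - 1) * m%:R * (m%:R + 1)
  - 4 * m%:R * (m%:R + 1) * (2 * m%:R + 1) :> R.
Proof.
move=> mk; rewrite natr_sum.
rewrite (@big_cat_nat _ _ _ k) ?(@big_cat_nat _ _ _ m.+1 0 k) //=; last by lia.
rewrite (@eq_big_nat _ _ _ 0 m.+1 _ (fun i => (2 * k%:R - i%:R) * i.+1%:R)); last first.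
  move=> i /andP[_ im]; rewrite /clique_bound -ltnS im natrM natrB ?natrM //; lia.
rewrite (@eq_big_nat _ _ _ m.+1 k _ (fun i => (2 * k%:R - i%:R) * k%:R)); last first.
  move=> i /andP[im ik]; rewrite /clique_bound leqNgt im leqNgt ik addn0.
  by rewrite natrM natrB ?natrM //; lia.
rewrite (@eq_big_nat _ _ _ k (2 * k) _ (fun i => (2 * k%:R - i%:R) * (k%:R + 1))); last first.
  move=> i /andP[ki ik]; rewrite /clique_bound ki ifF ?addn1; last by lia.
  by rewrite natrM natrB ?natrM -?natr1 //; lia.
have := sum_rectangle (2 * k%:R : R) k%:R m.+1 (k - m.+1); rewrite subnKC // => ->.
rewrite (_ : 2 * k = k + k)%N; last by lia.
by rewrite sum_staircase sum_rectangle natrB // -natr1; field.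
Qed.

(** The two bounds on [s] say that [m] is the floor of [(s - 1) / 2]. *)
Lemma clique_bound_numeric (R : realFieldType) (k m : nat) (s : R) :
  (2 <= k)%N -> s ^+ 2 = 8 * k%:R - 7 -> 2 * m%:R + 1 <= s -> s < 2 * m%:R + 3 ->
  24 * (\sum_(0 <= i < 2 * k) (2 * k - i) * clique_bound k m i)%N%:R <=
  48 * k%:R ^+ 3 + 84 * k%:R ^+ 2 - 72 * k%:R - (16 * k%:R ^+ 2 - 13) * s + 36 :> R.
Proof.
move=> k2 s2 ms sm.
have m0 : 0 <= m%:R :> R by rewrite ler0n.
(* Squaring the bounds on [s] yields [lo] and [hi], which confine [k] to a finite range for each
   [m]: none for 0, {2, 3} for 1, {4, 5, 6} for 2. *)
have lo : (m * (m + 1) <= 2 * (k - 1))%N.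
  rewrite -(ler_nat R) !natrM natrD natrB; last by lia.
  by nra.
have hi : (2 * (k - 1) < (m + 1) * (m + 2))%N.
  rewrite -(ltr_nat R) !natrM !natrD natrB; last by lia.
  by nra.
have mk : (m < k)%N by nia.
rewrite sum_clique_bound //.
case: m => [|[|[|m]]] in ms sm m0 lo hi mk *.
- by exfalso; lia.
- have : (k == 2)%N || (k == 3)%N by lia.
  by case/orP=> /eqP ?; subst k; nra.
- have : [|| (k == 4)%N, (k == 5)%N | (k == 6)%N] by lia.
  by case/or3P=> /eqP ?; subst k; nra.
move: ms sm lo m0; set y := m.+3 => ms sm lo m0.
have y3 : 3 <= y%:R :> R by rewrite ler_nat.
have lo' : y%:R * (y%:R + 1) <= 2 * (k%:R - 1) :> R.
  by move: lo; rewrite -(ler_nat R) !natrM natrD natrB //; lia.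
have k7 : 7 <= k%:R :> R by nra.
(* Replacing [s] by [2 y + 3], [y (y + 1)] by [2 (k - 1)] and then [y] by 3 leaves a gap of at least
   [24 k^2 - 180 k + 129], positive for [k >= 7]. *)
have : (16 * k%:R ^+ 2 - 13) * s <= (16 * k%:R ^+ 2 - 13) * (2 * y%:R + 3).
  by apply: ler_wpM2l; [nra | apply: ltW].
have : (36 * k%:R - 12) * (y%:R * (y%:R + 1)) <= (36 * k%:R - 12) * (2 * (k%:R - 1)) :> R.
  by apply: ler_wpM2l => //; lra.
have : 0 <= (y%:R - 3) * (16 * k%:R ^+ 2 - 48 * k%:R) :> R.
  by apply: mulr_ge0; [lra | nra].
have : 0 <= y%:R * (y%:R + 1) * (2 * y%:R + 1) :> R by nra.
have : 0 <= (k%:R - 4) ^+ 2 :> R by exact: sqr_ge0.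
nra.
Qed.

Theorem theorem3p5 (R : realType) (k : nat) (T : finType) (e : rel T)
    (e_sym : symmetric e) (e_irr : irreflexive e)
    (k_ge2 : (2 <= k)%N) (ktreeG : is_ktree e k)
    (n_ge : k%:Z + q R k + 2 <= #|T|%:Z) :
  (alpha_reg e)%:R >
    24 * k%:R /
      (48 * k%:R ^+ 3 + 84 * k%:R ^+ 2 - 72 * k%:R
       - (16 * k%:R ^+ 2 - 13) * Num.sqrt (8 * k%:R - 7) + 36)
    * #|T|%:R :> R.
Proof.
have k2 : 2 <= k%:R :> R by rewrite ler_nat.
set s := Num.sqrt _; have s2 : s ^+ 2 = 8 * k%:R - 7 by rewrite sqr_sqrtr //; lra.
have s1 : 1 <= s by rewrite -sqrtr1 ler_wsqrtr //; lra.
(* Since [s >= 1], the floor is nonnegative and can be treated as a natural number. *)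
have [m qm] : exists m : nat, q R k = m%:Z.
  by exists `|q R k|%N; rewrite gez0_abs // /q -/s floor_ge0; lra.
have /andP[qs sq] := floor_itv ((-1 + s) / 2).
rewrite -/(q R k) in qs sq; rewrite qm in n_ge qs sq.
rewrite intrD /= in sq.
have [ms sm] : 2 * m%:R + 1 <= s /\ s < 2 * m%:R + 3 by split; lra.
have leT : (k + m.+2 <= #|T|)%N by lia.
have := ktree_order_le e_sym e_irr ktreeG leT (ltnW k_ge2).
rewrite -(ler_nat R) natrM !natrD !natrM; set a := (alpha_reg e)%:R.
have := clique_bound_numeric k_ge2 s2 ms sm.
set S := (\sum_(0 <= i < _) _)%N%:R; set D : R := (_ + 36) => SD le.
have a0 : 0 <= a :> R by rewrite ler0n.
have n0 : 0 <= #|T|%:R :> R by rewrite ler0n.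
(* Strictness comes from the surplus [k * k.+1] in the degree count. *)
have aD : 24 * k%:R * #|T|%:R < a * D.
  have := ler_wpM2l a0 SD; nra.
(* No direct estimate of [D] is made: [a * D] is positive by [aD] and [a] is nonnegative. *)
have D0 : 0 < D by rewrite ltNge; apply/negP => D0; nra.
by rewrite mulrAC ltr_pdivrMr.
Qed.
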